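(* Fix $k,l,m,n\in\mathbb{N}$ with $k\le m$, $l\le n$, and $k,l$ even. For every set $\Gamma$ of formulas of $\mathcal{L}_{\mathsf{BCL}}$ and every formula $A$: if $\Gamma\vdash_{Ax_{\mathsf{BCL}}^{k,l,m,n}}A$, then $\Gamma\vDash_{\mathbf{R}^{k,l,m,n}}A$.
   Context: $\mathcal{L}_{\mathsf{BCL}}$ has variables $p_0,p_1,\dots$ (set $\mathrm{Var}$), unary $\neg$, binary $\wedge,\vee,\rightarrow$; $\mathrm{For}$ is its set of formulas. $A\supset B:=\neg A\vee B$; $\neg^jA$ is $A$ preceded by $j$ negations ($\neg^0A=A$). A model is a pair $\langle v,R\rangle$ with $v:\mathrm{Var}\to\{0,1\}$ and $R\subseteq\mathrm{For}\times\mathrm{For}$. Truth: $M\vDash p$ iff $v(p)=1$; $M\vDash\neg B$ iff $M\nvDash B$; $M\vDash B\wedge C$ iff both true; $M\vDash B\vee C$ iff at least one true; $M\vDash B\rightarrow C$ iff ($M\nvDash B$ or $M\vDash C$) and $R(B,C)$. Conditions on $R$ (for all formulas $A,B$): (a1) not $R(A,\neg A)$; (a2) not $R(\neg A,A)$; (b0) $R(A,B)\Rightarrow$ not $R(A,\neg B)$; (b1) $R(A\rightarrow B,\neg(A\rightarrow\neg B))$; (b2) $R(A\rightarrow\neg B,\neg(A\rightarrow B))$; (cun) $R(A,B)\Rightarrow R(\neg A,\neg B)$; (cun$^{k,l,m,n}$) $R(\neg^kA,\neg^lB)\Rightarrow R(\neg^mA,\neg^nB)$. $\mathbf{R}^{k,l,m,n}$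 is the class of relations satisfying all of (a1),(a2),(b0),(b1),(b2),(cun),(cun$^{k,l,m,n}$). $\Gamma\vDash_{\mathbf{R}^{k,l,m,n}}A$ means: for every model $\langle v,R\rangle$ with $R\in\mathbf{R}^{k,l,m,n}$, if all members of $\Gamma$ are true in it then $A$ is true in it. $Ax_{\mathsf{BCL}}^{k,l,m,n}$ is the Hilbert system with axiom schemata: (CPL) all substitution instances of classical propositional tautologies; (A1) $\neg(A\rightarrow\neg A)$; (A2) $\neg(\neg A\rightarrow A)$; (B1) $(A\rightarrow B)\rightarrow\neg(A\rightarrow\neg B)$; (B2) $(A\rightarrow\neg B)\rightarrow\neg(A\rightarrow B)$; (Imp) $(A\rightarrow B)\supset(A\supset B)$; (CUN1) $(A\rightarrow B)\supset((\neg A\rightarrow\neg B)\vee(\neg A\wedge B))$; (CUN2) $(A\rightarrow B)\supset(\neg\neg A\rightarrow\neg\neg B)$; (GCUN) $(\neg^kA\rightarrow\neg^lB)\supset((\neg^mA\rightarrow\neg^nB)\vee(\neg^mA\wedge\neg^{n+1}B))$; (GCUN2) $(\neg^kA\rightarrow\neg^lB)\supset(\neg^{2m-k}A\rightarrow\neg^{2n-l}B)$; and the single rule: from $A$ and $A\supset B$ infer $B$. $\Gamma\vdash A$ means $A$ is derivable from axioms and members of $\Gamma$ by this rule. *)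

(* Defs.v *)
From Stdlib Require Import Arith.

(** The language: variables [p_i] are indexed by [nat]; [Arr] is the connexive
    arrow, while material implication is the defined connective [Mat]. *)
Inductive form : Type :=
  | Var (i : nat)
  | Neg (A : form)
  | And (A B : form)
  | Or (A B : form)
  | Arr (A B : form).

Definition Mat (A B : form) : form := Or (Neg A) B.

Definition negn (j : nat) (A : form) : form := Nat.iter j Neg A.

Record model : Type := Model {
  val : nat -> bool;
  rel : form -> form -> Prop
}.

Fixpoint holds (M : model) (A : form) : Prop :=
  match A with
  | Var i => val M i = true
  | Neg B => ~ holds M B
  | And B C => holds M B /\ holds M C
  | Or B C => holds M B \/ holds M C
  | Arr B C => (~ holds M B \/ holds M C) /\ rel M B C
  end.

Definition cond_a1 (R : form -> form -> Prop) : Prop :=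
  forall A, ~ R A (Neg A).
Definition cond_a2 (R : form -> form -> Prop) : Prop :=
  forall A, ~ R (Neg A) A.
Definition cond_b0 (R : form -> form -> Prop) : Prop :=
  forall A B, R A B -> ~ R A (Neg B).
Definition cond_b1 (R : form -> form -> Prop) : Prop :=
  forall A B, R (Arr A B) (Neg (Arr A (Neg B))).
Definition cond_b2 (R : form -> form -> Prop) : Prop :=
  forall A B, R (Arr A (Neg B)) (Neg (Arr A B)).
Definition cond_cun (R : form -> form -> Prop) : Prop :=
  forall A B, R A B -> R (Neg A) (Neg B).
Definition cond_cun4 (R : form -> form -> Prop) (k l m n : nat) : Prop :=
  forall A B, R (negn k A) (negn l B) -> R (negn m A) (negn n B).

Definition class_R (R : form -> form -> Prop) (k l m n : nat) : Prop :=
  cond_a1 R /\ cond_a2 R /\ cond_b0 R /\ cond_b1 R /\ cond_b2 R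
  /\ cond_cun R /\ cond_cun4 R k l m n.

Definition entails (k l m n : nat) (Gamma : form -> Prop) (A : form) : Prop :=
  forall M : model, class_R (rel M) k l m n ->
    (forall B, Gamma B -> holds M B) -> holds M A.

(** The language of classical propositional logic is the arrow-free one, as
    material implication is definable in it. Its formulas form a separate type,
    so that the arrow enters a tautology only through substitution. *)
Inductive cform : Type :=
  | CVar (i : nat)
  | CNeg (a : cform)
  | CAnd (a b : cform)
  | COr (a b : cform).

Fixpoint ceval (v : nat -> bool) (a : cform) : bool :=
  match a with
  | CVar i => v i
  | CNeg b => negb (ceval v b)
  | CAnd b c => andb (ceval v b) (ceval v c)
  | COr b c => orb (ceval v b) (ceval v c)
  end.

Definition tautology (a : cform) : Prop := forall v, ceval v a = true.

Fixpoint subst (s : nat -> form) (a : cform) : form :=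
  match a with
  | CVar i => s i
  | CNeg b => Neg (subst s b)
  | CAnd b c => And (subst s b) (subst s c)
  | COr b c => Or (subst s b) (subst s c)
  end.

(** The truncated subtractions in [ax_GCUN2] are exact whenever [k <= m] and
    [l <= n]. *)
Inductive axiom (k l m n : nat) : form -> Prop :=
  | ax_CPL a s : tautology a -> axiom k l m n (subst s a)
  | ax_A1 A : axiom k l m n (Neg (Arr A (Neg A)))
  | ax_A2 A : axiom k l m n (Neg (Arr (Neg A) A))
  | ax_B1 A B : axiom k l m n (Arr (Arr A B) (Neg (Arr A (Neg B))))
  | ax_B2 A B : axiom k l m n (Arr (Arr A (Neg B)) (Neg (Arr A B)))
  | ax_Imp A B : axiom k l m n (Mat (Arr A B) (Mat A B))
  | ax_CUN1 A B :
      axiom k l m n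
        (Mat (Arr A B) (Or (Arr (Neg A) (Neg B)) (And (Neg A) B)))
  | ax_CUN2 A B :
      axiom k l m n (Mat (Arr A B) (Arr (Neg (Neg A)) (Neg (Neg B))))
  | ax_GCUN A B :
      axiom k l m n
        (Mat (Arr (negn k A) (negn l B))
             (Or (Arr (negn m A) (negn n B))
                 (And (negn m A) (negn (n + 1) B))))
  | ax_GCUN2 A B :
      axiom k l m n
        (Mat (Arr (negn k A) (negn l B))
             (Arr (negn (2 * m - k) A) (negn (2 * n - l) B))).

Inductive derivable (k l m n : nat) (Gamma : form -> Prop) : form -> Prop :=
  | der_ax A : axiom k l m n A -> derivable k l m n Gamma A
  | der_hyp A : Gamma A -> derivable k l m n Gamma A
  | der_mp A B :
      derivable k l m n Gamma A -> derivable k l m n Gamma (Mat A B) ->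
      derivable k l m n Gamma B.

(* Main.v *)
Require Import Defs.
From Stdlib Require Import Arith.
From Stdlib Require Import Lia Bool Classical ClassicalEpsilon.

(** Soundness is checked axiom by axiom. The only axiom that needs more than
    unfolding the truth clauses is (GCUN2): as [negn m A = negn k (negn (m - k) A)],
    applying (cun^{k,l,m,n}) twice leads from [negn k A], [negn l B] through
    [negn m A], [negn n B] to [negn (2 * m - k) A], [negn (2 * n - l) B], and since
    all the outer exponents are even the material conditional is unchanged. *)

Lemma negn_add (i j : nat) (A : form) : negn (i + j) A = negn i (negn j A).
Proof. exact (Nat.iter_add i j form Neg A). Qed.

Lemma holds_negn_even (M : model) (j : nat) (A : form) :
  Nat.Even j -> (holds M (negn j A) <-> holds M A).
Proof.
  intros [i ->]; induction i as [|i IH]; [reflexivity|].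
  replace (2 * S i) with (2 + 2 * i) by lia.
  rewrite negn_add; simpl negn at 1; simpl holds at 1.
  split; [intros H; apply IH, NNPP, H | tauto].
Qed.

(** The formulas inserted by [s], arrows included, act as atoms whose truth values [v] records; only
    the arrow-free skeleton [a] is evaluated. *)
Lemma holds_subst (M : model) (s : nat -> form) (v : nat -> bool) (a : cform) :
  (forall i, v i = true <-> holds M (s i)) ->
  (ceval v a = true <-> holds M (subst s a)).
Proof.
  intros Hv; induction a as [i|b IHb|b IHb c IHc|b IHb c IHc]; simpl.
  - apply Hv.
  - rewrite negb_true_iff, <- IHb, not_true_iff_false; reflexivity.
  - rewrite andb_true_iff, IHb, IHc; reflexivity.
  - rewrite orb_true_iff, IHb, IHc; reflexivity.
Qed.

Lemma tautology_holds (M : model) (s : nat -> form) (a : cform) :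
  tautology a -> holds M (subst s a).
Proof.
  intros Ha.
  (* Truth in [M] is a proposition, so a Boolean valuation is extracted by classical decision. *)
  set (v := fun i => if excluded_middle_informative (holds M (s i))
                     then true else false).
  apply (holds_subst M s v); [|apply Ha].
  intros i; unfold v; destruct excluded_middle_informative; split; easy.
Qed.

Lemma holds_Mat (M : model) (A B : form) :
  holds M (Mat A B) <-> (holds M A -> holds M B).
Proof. simpl; split; [tauto | apply imply_to_or]. Qed.

Lemma cond_cun4_twice (R : form -> form -> Prop) (k l m n : nat) (A B : form) :
  k <= m -> l <= n -> cond_cun4 R k l m n ->
  R (negn k A) (negn l B) -> R (negn (2 * m - k) A) (negn (2 * n - l) B).
Proof.
  intros hkm hln Hcun H%Hcun.
  replace (2 * m - k) with (m + (m - k)) by lia.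
  replace (2 * n - l) with (n + (n - l)) by lia.
  (* The second use of the condition is at [negn (m - k) A] and [negn (n - l) B]; its premise then
     collapses to [H] since [k <= m] and [l <= n]. *)
  rewrite !negn_add; apply Hcun; rewrite <- !negn_add.
  replace (k + (m - k)) with m by lia; replace (l + (n - l)) with n by lia.
  exact H.
Qed.

Lemma even_double_sub (j i : nat) : Nat.Even j -> Nat.Even (2 * i - j).
Proof. intros [a ->]; exists (i - a); lia. Qed.

Lemma axiom_holds (k l m n : nat) (M : model) (A : form) :
  k <= m -> l <= n -> Nat.Even k -> Nat.Even l ->
  class_R (rel M) k l m n -> axiom k l m n A -> holds M A.
Proof.
  intros hkm hln hk hl (Ha1 & Ha2 & Hb0 & Hb1 & Hb2 & Hcun & Hcun4) HA.
  destruct HA as [a s Ha|A|A|A B|A B|A B|A B|A B|A B|A B].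
  - exact (tautology_holds M s a Ha).
  - intros [_ H]; exact (Ha1 A H).
  - intros [_ H]; exact (Ha2 A H).
  - split; [|apply Hb1].
    (* The material part of the outer arrow: by (b0) the two inner arrows are never true
       together. *)
    apply imply_to_or; intros [_ H] [_ H']; exact (Hb0 A B H H').
  - split; [|apply Hb2].
    apply imply_to_or; intros [_ H'] [_ H]; exact (Hb0 A B H H').
  - rewrite !holds_Mat; simpl; tauto.
  (* (cun) supplies the relation for the negated arrow, which can then fail only if [Neg A] and [B]
     are both true: exactly the second disjunct. *)
  - rewrite holds_Mat; intros [HAB H%Hcun]; simpl.
    destruct (classic (holds M A)), (classic (holds M B)); tauto.
  - rewrite holds_Mat; intros [HAB H%Hcun%Hcun]; simpl.
    destruct (classic (holds M A)); tauto.
  (* Likewise, once the relation holds, the new arrow fails only if [negn m A] is true and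
     [negn n B] false; the extra negation in [n + 1] expresses the latter. *)
  - rewrite holds_Mat; intros [_ H%Hcun4].
    rewrite Nat.add_1_r; change (negn (S n) B) with (Neg (negn n B)); simpl.
    destruct (classic (holds M (negn m A))), (classic (holds M (negn n B)));
      tauto.
  - rewrite holds_Mat; intros [HAB H]; split.
    + rewrite !holds_negn_even in * by auto using even_double_sub; exact HAB.
    + exact (cond_cun4_twice _ _ _ _ _ _ _ hkm hln Hcun4 H).
Qed.

Theorem mainTheorem3 (k l m n : nat)
  (hkm : k <= m) (hln : l <= n) (hk : Nat.Even k) (hl : Nat.Even l)
  (Gamma : form -> Prop) (A : form) :
  derivable k l m n Gamma A -> entails k l m n Gamma A.
Proof.
  intros HA M HM HGamma.
  induction HA as [A HA|A HA|A B _ IHA _ IHAB].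
  - exact (axiom_holds k l m n M A hkm hln hk hl HM HA).
  - exact (HGamma A HA).
  - exact (proj1 (holds_Mat M A B) IHAB IHA).
Qed.
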